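(* Let $p$ be a prime number such that $p \equiv 1 \pmod 4$. Then: (i) if $p \equiv 1 \pmod 8$, then $\kappa(8p) \equiv 2 \pmod 4$; (ii) if $p \equiv 5 \pmod 8$, then $\kappa(8p) \equiv 0 \pmod 4$.
   Context: A real quadratic number is a real irrational root $w$ of a quadratic polynomial with integer coefficients; $w'$ denotes its algebraic conjugate over $\mathbb{Q}$. The discriminant $\mathrm{disc}(w)$ of $w$ is $b^2-4ac$, where $aw^2+bw+c=0$ with $a,b,c\in\mathbb{Z}$, $a>0$, $\gcd(a,b,c)=1$. A real quadratic number $w$ is reduced if $w>1$ and $-1<w'<0$. For a positive non-square integer $D$, $\kappa(D)$ denotes the (finite) number of reduced real quadratic numbers $w$ with $\mathrm{disc}(w)=D$. *)

(* Defs.v *)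
From HB Require Import structures.
From mathcomp Require Import all_boot all_order all_algebra finmap.
From mathcomp Require Import ring lra zify.
From mathcomp Require Import boolp classical_sets functions cardinality reals.

Set Implicit Arguments.
Unset Strict Implicit.
Unset Printing Implicit Defensive.

Import Order.TTheory GRing.Theory Num.Theory.
Local Open Scope classical_set_scope.
Local Open Scope ring_scope.

Definition quad_root (R : realType) (a b c : int) (w : R) : Prop :=
  a%:~R * w ^+ 2 + b%:~R * w + c%:~R = 0.

Definition real_quadratic (R : realType) (w : R) : Prop :=
  irrational w /\ exists a b c : int, a != 0 /\ quad_root a b c w.

(* The algebraic conjugate over Q other than w itself: a second real root of
   the irreducible polynomial of w. *)
Definition conjugate (R : realType) (w w' : R) : Prop :=
  w' != w /\
  exists mu : {poly rat}, [/\ irreducible_poly mu,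
    root (map_poly ratr mu) w & root (map_poly ratr mu) w'].

Definition has_disc (R : realType) (w : R) (D : int) : Prop :=
  exists a b c : int, [/\ quad_root a b c w, 0 < a, gcdz (gcdz a b) c = 1
    & D = b ^+ 2 - 4 * a * c].

Definition reduced (R : realType) (w : R) : Prop :=
  [/\ real_quadratic w, 1 < w
    & exists2 w', conjugate w w' & -1 < w' < 0].

Definition reduced_of_disc (R : realType) (D : nat) : set R :=
  [set w | reduced w /\ has_disc w D%:Z].

Lemma conjugate_quad_root (R : realType) (a b c : int) (w w' : R) :
  quad_root a b c w -> conjugate w w' -> quad_root a b c w'.
Proof.
pose P : {poly rat} := a%:~R *: 'X^2 + b%:~R *: 'X + c%:~R%:P.
have PE x : (map_poly ratr P).[x] = a%:~R * x ^+ 2 + b%:~R * x + c%:~R :> R.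
  rewrite /P !rmorphD /= !map_polyZ map_polyXn map_polyX map_polyC /=.
  by rewrite !ratr_int !hornerE.
rewrite /quad_root -!PE => Pw [_ [mu [[sz irr] muw muw']]].
have [|cop] := boolP (coprimep mu P).
  rewrite -(coprimep_map (ratr : {rmorphism rat -> R})) => /coprimep_root.
  by move=> /(_ _ muw); rewrite Pw eqxx.
have gmu : gcdp mu P %= mu.
  by apply: irr; [rewrite -coprimep_def | exact: dvdp_gcdl].
have : (mu %| P)%R by rewrite -(eqp_dvdl _ gmu) dvdp_gcdr.
rewrite -(dvdp_map (ratr : {rmorphism rat -> R})) => dvd.
by apply/rootP; rewrite (root_dvdp dvd).
Qed.

Lemma reduced_of_disc_finite (R : realType) (D : nat) :
  finite_set (@reduced_of_disc R D).
Proof.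
pose f (k m : nat) : R := (Num.sqrt D%:R + m%:R) / (2 * k%:R).
apply: (@sub_finite_set _ _ [set f k m | k in `I_D.+1 & m in `I_D.+1]);
  last exact: finite_image2.
move=> w [[_ w1 [w' cw /andP[w'1 w'0]]] [a [b [c [rw a0 _ Dabc]]]]].
have rw' := conjugate_quad_root rw cw.
have ww' : w - w' != 0 by rewrite subr_eq0 eq_sym; case: cw.
rewrite /quad_root in rw rw'.
set A : R := a%:~R in rw rw'; set B : R := b%:~R in rw rw'.
set C : R := c%:~R in rw rw'.
have A0 : 0 < A by rewrite ltr0z.
have AB : A * (w + w') + B = 0.
  apply: (mulfI ww'); rewrite mulr0 -[RHS](subrr 0) -{1}rw -{1}rw'; ring.
have EB : B = - (A * (w + w')) by apply/eqP; rewrite -addr_eq0 addrC AB.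
have EC : C = A * w * w' by rewrite -[LHS]addr0 -[0]oppr0 -rw EB; ring.
have b0 : b < 0.
  rewrite -(@ltrz0 R) -/B EB oppr_lt0 mulr_gt0 //; lra.
have c0 : c < 0.
  rewrite -(@ltrz0 R) -/C EC pmulr_rlt0 ?mulr_gt0 //; lra.
have ED : D%:R = (A * (w - w')) ^+ 2 :> R.
  have -> : D%:R = B ^+ 2 - 4 * A * C :> R.
    by rewrite -[D%:R]/(D%:Z%:~R) Dabc rmorphB !rmorphM /=.
  by rewrite EB EC; ring.
have sD : Num.sqrt D%:R = A * (w - w') :> R.
  by rewrite ED sqrtr_sqr ger0_norm // mulr_ge0 ?(ltW A0) //; lra.
exists `|a|%N; first by rewrite /= ltnS; nia.
exists `|b|%N; first by rewrite /= ltnS; nia.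
rewrite /f sD !natr_absz (gtr0_norm a0) (ltr0_norm b0) rmorphN /= -/A -/B EB.
by field; rewrite gt_eqF.
Qed.

(* fset_set sends an infinite set to the empty one; reduced_of_disc_finite
   shows that this default value is never used here. *)
Definition kappa (R : realType) (D : nat) : nat :=
  #|` fset_set (@reduced_of_disc R D)|.

(* Main.v *)
(* A reduced number (b + sqrt (2 p)) / a of discriminant 8 p corresponds to a
   triple of positive integers with b^2 + a c = 2 p and |a - c| < 2 b, so kappa
   counts such triples; modulo 4 this is done with involutions.
   Exchanging a and c reduces each part of the count to a parity.
   - If exactly one of a, c is even, say a, the substitutions X -> X + 1 and
     X -> X - 1 in the quadratic a X^2 - 2 b X - c pair off everything but the
     triple (2, 2, p - 2): this part contributes 2 modulo 4.
   - The diagonal a = c consists of the two ways to write 2 p as an ordered sum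
     of two squares: it contributes 2.
   - If a < c have the same parity, exchanging a + c and 2 b in
     8 p = (a + c)^2 + (2 b)^2 - (c - a)^2 is an involution whose fixed points
     are the solutions of p = x^2 - 2 y^2 with 0 < 2 y < x. That is a
     fundamental domain for the units of Z[sqrt 2]: there is exactly one
     solution for p = 1 mod 8, and none for p = 5 mod 8. *)

Require Import Defs.
From mathcomp Require Import all_boot all_order all_algebra finfield finmap.
From mathcomp Require Import ring lra zify.
From mathcomp Require Import classical_sets cardinality reals.

Set Implicit Arguments.
Unset Strict Implicit.
Unset Printing Implicit Defensive.

Import Order.TTheory GRing.Theory Num.Theory.

(** * Counting finite sets with involutions *)

Section FsetCounting.
Local Open Scope fset_scope.

Lemma in_fset_filter (K : choiceType) (A : {fset K}) (q : pred K) x :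
  (x \in [fset y in A | q y]) = (x \in A) && q x.
Proof. by rewrite !inE. Qed.

Lemma card_fset_bij (K L : choiceType) (A : {fset K}) (B : {fset L})
    (f : K -> L) (g : L -> K) :
    {in A, forall x, f x \in B /\ g (f x) = x} ->
    {in B, forall y, g y \in A /\ f (g y) = y} ->
  #|` A| = #|` B|.
Proof.
move=> fA gB; have -> : B = f @` A.
  apply/fsetP => y; apply/idP/imfsetP => [yB|[x xA ->]].
    by have [gyA fgy] := gB y yB; exists (g y).
  by have [] := fA x xA.
rewrite card_in_imfset // => x y xA yA /(congr1 g).
by rewrite (fA x xA).2 (fA y yA).2.
Qed.

(** Points that are not fixed fall into orbits [{x, f x}] of size two; the induction removes one
    orbit at a time. *)
Lemma odd_card_involution (K : choiceType) (A : {fset K}) (f : K -> K) :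
    {in A, forall x, f x \in A /\ f (f x) = x} ->
  odd #|` A| = odd #|` [fset x in A | f x == x]|.
Proof.
have [n] := ubnP #|` A|; elim: n A => // n IH A leAn fA.
have [/fset0Pn[x]|] := boolP ([fset x in A | f x != x] != fset0); last first.
  rewrite negbK => /eqP/fsetP fix_f; congr (odd #|` _|); apply/fsetP => x.
  by move: (fix_f x); rewrite !inE; case: (x \in A) => //= /negbFE.
rewrite !inE => /andP[xA fxNx].
have [fxA ffx] := fA x xA.
pose B := A `\ x `\ f x.
have cA : #|` A| = #|` B|.+2.
  by rewrite (cardfsD1 x) xA (cardfsD1 (f x)) !inE fxNx fxA.
rewrite cA /= negbK IH //.
- congr (odd #|` _|); apply/fsetP => y; rewrite !inE.
  have [->|] := eqVneq y (f x); first by rewrite ffx (eq_sym x) (negPf fxNx)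
    !andbF.
  by have [->|] := eqVneq y x; rewrite //= (negPf fxNx) !andbF.
- by move: leAn; rewrite cA; lia.
- move=> y; rewrite !inE => /and3P[yNfx yNx yA]; have [fyA ffy] := fA y yA.
  rewrite fyA ffy andbT; split=> //; apply/andP; split.
    by apply: contraNneq yNx => /(congr1 f); rewrite ffy ffx => ->.
  by apply: contraNneq yNfx => <-; rewrite ffy.
Qed.

Lemma even_card_free_involution (K : choiceType) (A : {fset K}) (f : K -> K) :
    {in A, forall x, [/\ f x \in A, f (f x) = x & f x != x]} ->
  ~~ odd #|` A|.
Proof.
move=> fA; rewrite (@odd_card_involution _ _ f) => [|x /fA[]]; last by [split].
suff -> : [fset x in A | f x == x] = fset0 by rewrite cardfs0.
apply/fsetP => x; rewrite !inE; apply/negP => /andP[/fA[_ _ /negPf->]] //.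
Qed.

Lemma card_fset_sieve (K : choiceType) (A : {fset K}) (q : pred K) :
  #|` A| = (#|` [fset x in A | q x]| + #|` [fset x in A | ~~ q x]|)%N.
Proof.
rewrite -(cardfsID [fset x in A | q x] A).
have -> : A `&` [fset x in A | q x] = [fset x in A | q x].
  by apply/fsetP => x; rewrite !inE; case: (x \in A).
suff -> : A `\` [fset x in A | q x] = [fset x in A | ~~ q x] by [].
by apply/fsetP => x; rewrite !inE; case: (x \in A); rewrite ?andbT.
Qed.
End FsetCounting.

(** * Positive solutions of $b^2 + ac = 2p$ as finite sets *)

Section Forms.
Local Open Scope ring_scope.

(* The triple (a, b, c) stands for the quadratic a X^2 - 2 b X - c of
   discriminant 8 p. *)
Definition forms (p : nat) (P : int -> int -> int -> bool) :
    {fset int * int * int} :=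
  let r := [seq Posz i | i <- iota 1 (2 * p)] in
  [fset t in [seq (x, z) | x <- [seq (x, y) | x <- r, y <- r], z <- r] |
    let: (a, b, c) := t in
    [&& 0 < a, 0 < b, 0 < c, b ^+ 2 + a * c == (2 * p)%:Z & P a b c]%R]%fset.

(** The bounding box loses no solution: for positive integers $b \le b^2$, $a \le ac$ and $c \le
    ac$, so every entry is at most $2p$. *)
Lemma in_forms p P a b c : ((a, b, c) \in forms p P) =
  [&& 0 < a, 0 < b, 0 < c, b ^+ 2 + a * c == (2 * p)%:Z & P a b c].
Proof.
rewrite !inE; apply: andb_idl => /and5P[a0 b0 c0 /eqP E _].
have [a1 b1 c1] : [/\ a <= (2 * p)%:Z, b <= (2 * p)%:Z & c <= (2 * p)%:Z].
  have := mulr_ge0 (ltW b0) (_ : 0 <= b - 1).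
  have := mulr_ge0 (ltW a0) (_ : 0 <= c - 1).
  have := mulr_ge0 (ltW c0) (_ : 0 <= a - 1).
  by split; lia.
set r := map Posz _.
have inr (x : int) : 0 < x -> x <= (2 * p)%:Z -> x \in r.
  move=> x0 lex; apply/mapP; exists `|x|%N; last by lia.
  by rewrite mem_iota; lia.
apply/allpairsP; exists ((a, b), c); split=> //=; last exact: inr.
by apply/allpairsP; exists (a, b); split=> //=; apply: inr.
Qed.

Lemma eq_forms p P Q :
    (forall a b c : int, 0 < a -> 0 < b -> 0 < c ->
       b ^+ 2 + a * c = (2 * p)%:Z -> P a b c = Q a b c) ->
  forms p P = forms p Q.
Proof.
move=> PQ; apply/fsetP => -[[a b] c]; rewrite !in_forms.
case a0: (0 < a) => //; case b0: (0 < b) => //; case c0: (0 < c) => //=.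
by have [E|//] := eqVneq; rewrite /= PQ.
Qed.

Lemma card_forms_sieve p P (q : int -> int -> int -> bool) :
  #|` forms p P| = (#|` forms p (fun a b c => P a b c && q a b c)|
                  + #|` forms p (fun a b c => P a b c && ~~ q a b c)|)%N.
Proof.
rewrite (card_fset_sieve _ (fun t => q t.1.1 t.1.2 t.2)).
congr (_ + _)%N; apply: (congr1 (fun A : {fset _} => #|` A|));
  by apply/fsetP => -[[a b] c]; rewrite in_forms in_fset_filter in_forms /=
    -!andbA.
Qed.

Lemma card_forms_swap p P :
  #|` forms p P| = #|` forms p (fun a b c => P c b a)|.
Proof.
pose f (t : int * int * int) := (t.2, t.1.2, t.1.1).
apply: (@card_fset_bij _ _ _ _ f f) => -[[a b] c];
  rewrite in_forms => /and5P[? ? ? E ?]; split=> //; rewrite in_forms;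
  by apply/and5P; split; rewrite // mulrC.
Qed.
End Forms.

(** * Norms from Z[i] and Z[sqrt 2] *)

(** The exponent of [q] is even in $n^2$ and, when $m \ne 0$, odd in $qkm^2$. This supplies the
    irrationality of $\sqrt 2$, $\sqrt 3$, $\sqrt p$ and $\sqrt{2p}$ wherever it is needed below. *)
Lemma sqr_eq_prime_mul (q k n m : nat) :
  prime q -> ~~ (q %| k) -> n ^ 2 = q * k * m ^ 2 -> m = 0.
Proof.
move=> q_prime qk E; case: m E => // m E; exfalso.
have k0 : 0 < k by case: k qk {E} => //; rewrite dvdn0.
have q0 := prime_gt0 q_prime.
have logk : logn q k = 0 by rewrite lognE q_prime k0 (negPf qk).
have logm := lognX q m.+1 2; have := lognX q n 2.
rewrite E lognM ?muln_gt0 ?q0 // lognM // logn_prime // eqxx logk logm; lia.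
Qed.

Lemma sqrz_eq_prime_mul (q k : nat) (n m : int) :
  prime q -> ~~ (q %| k) -> (n ^+ 2 = (q * k)%:Z * m ^+ 2)%R -> m = 0%R.
Proof.
move=> q_prime qk E; suff : `|m|%N = 0 by lia.
by apply: (sqr_eq_prime_mul (n := `|n|%N) q_prime qk); lia.
Qed.

Section Thue.
Local Open Scope ring_scope.
Variable p : nat.
Hypothesis p_prime : prime p.

Lemma exists_sqrtn (n : nat) : exists m : nat, (m ^ 2 <= n < m.+1 ^ 2)%N.
Proof.
elim: n => [|n [m /andP[mn nm]]]; first by exists 0%N.
have [lt|ge] := ltnP n.+1 (m.+1 ^ 2); first by exists m; rewrite lt andbT; lia.
by exists m.+1; rewrite ge /=; lia.
Qed.

(** Pigeonhole: with $n = \lfloor \sqrt p \rfloor$ there are $(n+1)^2 > p$ pairs $(i, j)$, so $i -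
    zj$ takes some value twice, and the differences of coordinates give $x$ and $y$. The bounds are
    strict because a prime is not a square. *)
Lemma thue (z : 'F_p) : exists x y : int,
  [/\ (x, y) != (0, 0), x ^+ 2 < p%:Z, y ^+ 2 < p%:Z & x%:~R = z * y%:~R].
Proof.
have [n /andP[]] := exists_sqrtn p.
rewrite leq_eqVlt => /orP[/eqP E|n_lt] n_gt.
  have p1 : ~~ (p %| 1)%N by rewrite dvdn1; have := prime_gt1 p_prime; lia.
  by have := @sqr_eq_prime_mul p 1 n 1 p_prime p1; rewrite E; lia.
pose f (ij : 'I_n.+1 * 'I_n.+1) : 'F_p := ij.1%:R - z * ij.2%:R.
have /injectivePn[[i j] [[k l] neq eq_f]] : ~~ injectiveb f.
  apply/negP => /injectiveP/leq_card.
  by rewrite card_prod !card_ord Fp_cast // leqNgt mulnn n_gt.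
exists (i%:Z - k%:Z), (j%:Z - l%:Z); split.
- apply: contraNneq neq => -[ik jl]; apply/eqP; congr (_, _);
    apply: val_inj => /=; lia.
- by have := ltn_ord i; have := ltn_ord k; nia.
- by have := ltn_ord j; have := ltn_ord l; nia.
- move: eq_f; rewrite /f /= => eq_f; rewrite !rmorphB /= -!pmulrn.
  apply/eqP; rewrite -subr_eq0; apply/eqP.
  transitivity ((i%:R - z * j%:R) - (k%:R - z * l%:R)); first by ring.
  by rewrite eq_f subrr.
Qed.

Lemma dvdp_Fp (n : int) : (p %| n)%Z = (n%:~R == 0 :> 'F_p).
Proof. exact: dvdz_pcharf (pchar_Fp p_prime) n. Qed.

(** $X^k - 1$ has at most $k$ roots among the $2k$ units, so some unit has $z^k \ne 1$; as $z^{2k} =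
    1$, that power is $-1$. *)
Lemma exists_Fp_half_power k : p = (2 * k).+1 -> exists z : 'F_p, z ^+ k = -1.
Proof.
move=> pk; have p1 := prime_gt1 p_prime.
have k0 : (0 < k)%N by lia.
have [z z0 zk] : exists2 z : 'F_p, z != 0 & z ^+ k != 1.
  pose rs := enum (predC1 (0 : 'F_p)).
  have szrs : size rs = (2 * k)%N by rewrite -cardE cardC1 card_Fp //; lia.
  have [/allP all1|/allPn[z]] := boolP (all (fun x => x ^+ k == 1) rs).
    have P0 : 'X^k - 1 != 0 :> {poly 'F_p}.
      by rewrite -size_poly_gt0 size_XnsubC.
    have := max_poly_roots P0 (rs := rs).
    rewrite size_XnsubC // szrs => H; exfalso.
    suff : (2 * k < k.+1)%N by lia.
    apply: H; last exact: enum_uniq.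
    by apply/allP => x /all1 /eqP xk; rewrite /root !hornerE xk subrr.
  by rewrite mem_enum; exists z.
exists z; have : z ^+ (2 * k) = 1.
  apply: (mulfI z0); rewrite -exprS -pk mulr1.
  by rewrite -[X in _ ^+ X](card_Fp p_prime) expf_card.
rewrite mulnC exprM => /eqP; rewrite sqrf_eq1 (negPf zk) /=.
by move/eqP.
Qed.

(** A suitable $z^{(p-1)/4}$ is a square root of $-1$, so the pair from [thue] makes $x^2 + y^2$ a
    multiple of $p$ strictly between $0$ and $2p$. *)
Lemma exists_sum_two_squares :
  p = 1 %[mod 4] -> exists x y : int, x ^+ 2 + y ^+ 2 = p%:Z.
Proof.
move=> p4; have p1 := prime_gt1 p_prime.
have [z zE] : exists z : 'F_p, z ^+ (2 * (p %/ 4)) = -1.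
  by apply: exists_Fp_half_power; lia.
have [x [y [xy0 xp yp E]]] := thue (z ^+ (p %/ 4)).
exists x, y; have : (p %| x ^+ 2 + y ^+ 2)%Z.
  rewrite dvdp_Fp rmorphD !rmorphXn /= E exprMn -exprM mulnC zE.
  by rewrite mulN1r addNr.
have xy1 : 0 < x ^+ 2 + y ^+ 2.
  rewrite lt_neqAle addr_ge0 ?sqr_ge0 // andbT eq_sym paddr_eq0 ?sqr_ge0 //.
  by rewrite !sqrf_eq0.
move=> /dvdzP[q qE]; rewrite qE; suff -> : q = 1 by rewrite mul1r.
by rewrite qE in xy1; have : q * p%:Z < 2 * p%:Z by [lia]; nia.
Qed.

Lemma exists_norm_sqrt2 :
  p = 1 %[mod 8] -> exists x y : int,
    [/\ 0 < y, 2 * y < x & x ^+ 2 - 2 * y ^+ 2 = p%:Z].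
Proof.
move=> p8; have p1 := prime_gt1 p_prime.
pose k := (p %/ 8)%N.
have [z zE] : exists z : 'F_p, z ^+ (4 * k) = -1.
  by apply: exists_Fp_half_power; rewrite /k; lia.
have wE : (z ^+ k) ^+ 4 = -1 by rewrite -exprM mulnC.
(* For $w = z^k$ with $w^4 = -1$, the element $w - w^3 = w + w^{-1}$ squares to $2$. *)
have [x [y [xy0 xp yp E]]] := thue (z ^+ k - (z ^+ k) ^+ 3).
have : (p %| x ^+ 2 - 2 * y ^+ 2)%Z.
  rewrite dvdp_Fp !expr2 rmorphB /= !rmorphM /= E; set w := z ^+ k in wE *.
  apply/eqP; transitivity ((w ^+ 4 + 1) * (w ^+ 2 - 2) * y%:~R ^+ 2 : 'F_p);
    first by ring.
  by rewrite wE addNr !mul0r.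
have x2y0 : x ^+ 2 - 2 * y ^+ 2 != 0.
  apply: contraNneq xy0 => E0.
  have y0 : y = 0 by apply: (@sqrz_eq_prime_mul 2 1 x) => //; lia.
  by move: E0; rewrite y0 => x0; apply/eqP; congr (_, _); nia.
move=> /dvdzP[q qE].
(* Of the multiples of $p$ strictly between $-2p$ and $p$, only $-p$ is nonzero. *)
have {qE} : x ^+ 2 - 2 * y ^+ 2 = - p%:Z.
  rewrite qE; suff -> : q = -1 by rewrite mulN1r.
  have := sqr_ge0 x; have := sqr_ge0 y => y2 x2; rewrite qE in x2y0.
  have p0 : 0 < p%:Z by lia.
  have lt_q : -2 < q by rewrite -(ltr_pM2r p0); lia.
  have q_lt : q < 1 by rewrite -(ltr_pM2r p0); lia.
  by have : q != 0 by [apply: contraNneq x2y0 => ->; rewrite mul0r]; lia.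
have [X [x0 XE]] : exists X : int, 0 <= X /\ x ^+ 2 = X ^+ 2.
  by exists `|x|; rewrite normr_ge0 real_normK ?num_real.
have [Y [y0 YE]] : exists X : int, 0 <= X /\ y ^+ 2 = X ^+ 2.
  by exists `|y|; rewrite normr_ge0 real_normK ?num_real.
rewrite XE YE in yp xp * => {}E.
have X0 : X != 0 by apply/eqP => X0; move: E p8; rewrite X0; lia.
have XY : X < Y by nia.
(* Multiplying by the unit $\sqrt 2 - 1$ of norm $-1$ and conjugating turns norm $-p$ into $p$; here
   $2y < x$ amounts to $0 < X$. *)
by exists (2 * Y - X), (Y - X); split; lia.
Qed.

(* p divides (x v - u y) (x v + u y). In the first case the two solutions are
   proportional; in the second x v + u y = p and the norm of the product
   would give (x u + 2 y v)^2 = 3 p^2. *)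
Lemma norm_sqrt2_unique (x y u v : int) :
    0 < y -> 2 * y < x -> 0 < v -> 2 * v < u ->
    x ^+ 2 - 2 * y ^+ 2 = p%:Z -> u ^+ 2 - 2 * v ^+ 2 = p%:Z ->
  x = u /\ y = v.
Proof.
move=> y0 yx v0 vu Exy Euv.
have dvd : (p %| (x * v - u * y) * (x * v + u * y))%Z.
  apply/dvdzP; exists (v ^+ 2 - y ^+ 2).
  by rewrite [RHS]mulrBl -{1}Exy -Euv; ring.
have p0 : 0 < p%:Z by have := prime_gt0 p_prime; lia.
(* From $2y < x$ follow $2y^2 < p$ and $x^2 < 2p$; hence $xv$ and $uy$ are below $p$, which leaves a
   single possible quotient in each case. *)
have y2p : 2 * y ^+ 2 < p%:Z by nia.
have v2p : 2 * v ^+ 2 < p%:Z by nia.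
have mul_lt (a b : int) : 0 < a -> 0 < b ->
    a ^+ 2 < 2 * p%:Z -> 2 * b ^+ 2 < p%:Z -> a * b < p%:Z.
  move=> a0 b0 ap bp; rewrite -(@ltr_pXn2r _ 2) ?nnegrE; try lia.
  have : a ^+ 2 * (2 * b ^+ 2) < 2 * p%:Z * p%:Z by apply: ltr_pM; lia.
  lia.
have xv := mul_lt x v ltac:(lia) v0 ltac:(lia) v2p.
have uy := mul_lt u y ltac:(lia) y0 ltac:(lia) y2p.
have xv0 : 0 < x * v by apply: mulr_gt0; lia.
have uy0 : 0 < u * y by apply: mulr_gt0; lia.
move: dvd; rewrite dvdzE abszM Euclid_dvdM // -!dvdzE => /orP[] /dvdzP[q qE].
  have {q qE} E : x * v = u * y.
    suff q0 : q = 0 by move: qE; rewrite q0; lia.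
    have q_lt : q < 1 by rewrite -(ltr_pM2r p0); lia.
    have lt_q : -1 < q by rewrite -(ltr_pM2r p0); lia.
    by lia.
  have vy : v ^+ 2 = y ^+ 2.
    have : (v ^+ 2 - y ^+ 2) * p%:Z = 0.
      rewrite mulrBl -{1}Exy -Euv.
      transitivity ((x * v) ^+ 2 - (u * y) ^+ 2); first by ring.
      by rewrite E subrr.
    move/eqP; rewrite mulf_eq0 => /orP[]/eqP; lia.
  have {}vy : v = y by nia.
  by split=> //; nia.
have q_lt : q < 2 by rewrite -(ltr_pM2r p0); lia.
have q_gt : 0 < q by rewrite -(ltr_pM2r p0); lia.
have q1 : q = 1 by lia.
have sq3 : (x * u + 2 * y * v) ^+ 2 = (3 * 1)%:Z * p%:Z ^+ 2.
  transitivity ((x ^+ 2 - 2 * y ^+ 2) * (u ^+ 2 - 2 * v ^+ 2)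
                + 2 * (x * v + u * y) ^+ 2); first by ring.
  by rewrite qE q1 Exy Euv; ring.
by have := @sqrz_eq_prime_mul 3 1 _ _ isT isT sq3; have := prime_gt0 p_prime;
  lia.
Qed.

Lemma sum_two_squares_parity (a b : int) :
    odd p -> a ^+ 2 + b ^+ 2 = (2 * p)%:Z ->
  exists k l : int, a = 2 * k + 1 /\ b = 2 * l + 1.
Proof.
move=> p_odd E; exists (a %/ 2)%Z, (b %/ 2)%Z.
move: E; have := divz_eq a 2; have := divz_eq b 2.
have : (a %% 2)%Z = 0 \/ (a %% 2)%Z = 1 by lia.
have : (b %% 2)%Z = 0 \/ (b %% 2)%Z = 1 by lia.
move: (a %/ 2)%Z (b %/ 2)%Z => k l.
by case=> -> [] -> -> ->; move: p_odd; clear; lia.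
Qed.

(** $p$ divides $(xv - uy)(xv + uy)$, both factors are even since all four numbers are odd, and $(xv
    + uy)^2 + (xu - yv)^2 = (2p)^2$ with $xu < yv$ keeps them below $2p$ in absolute value. Only $xv
    = uy$ survives, and the two solutions are proportional. *)
Lemma sum_two_squares_unique (x y u v : int) :
    odd p -> 0 < x -> x < y -> 0 < u -> u < v ->
    x ^+ 2 + y ^+ 2 = (2 * p)%:Z -> u ^+ 2 + v ^+ 2 = (2 * p)%:Z ->
  x = u /\ y = v.
Proof.
move=> p_odd x0 xy u0 uv Exy Euv.
have y0 : 0 < y := lt_trans x0 xy; have v0 : 0 < v := lt_trans u0 uv.
have p0 : 0 < p%:Z by rewrite ltz_nat prime_gt0.
have xv0 : 0 < x * v := mulr_gt0 x0 v0.
have uy0 : 0 < u * y := mulr_gt0 u0 y0.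
have dvd : (p %| (x * v - u * y) * (x * v + u * y))%Z.
  apply/dvdzP; exists (2 * (v ^+ 2 - y ^+ 2)).
  transitivity ((v ^+ 2 - y ^+ 2) * (2 * p)%:Z); last by rewrite PoszM; ring.
  by rewrite [RHS]mulrBl -{1}Exy -Euv; ring.
have norm : (x * v + u * y) ^+ 2 + (x * u - y * v) ^+ 2 = (2 * p%:Z) ^+ 2.
  transitivity ((x ^+ 2 + y ^+ 2) * (u ^+ 2 + v ^+ 2)); first by ring.
  by rewrite Exy Euv PoszM.
have xuyv : x * u - y * v != 0.
  by rewrite subr_eq0 lt_eqF // ltr_pM // ltW.
have sum_lt : x * v + u * y < 2 * p%:Z.
  rewrite -(@ltr_pXn2r _ 2) ?nnegrE -?norm ?ltrDl ?exprn_even_gt0 //.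
    by rewrite addr_ge0 // ltW.
have even_sub : (2 %| x * v - u * y)%Z.
  have x2 := sum_two_squares_parity p_odd Exy.
  have u2 := sum_two_squares_parity p_odd Euv.
  by rewrite -[2]/2%:Z; case: x2 u2 => [k [l [-> ->]]] [m [n [-> ->]]];
    apply/dvdzP;
    exists (2 * k * n + k + n - 2 * m * l - m - l); ring.
move: dvd; rewrite dvdzE abszM Euclid_dvdM // -!dvdzE => /orP[] /dvdzP[q qE].
  have E : x * v = u * y.
    have /andP[] : -2 < q < 2.
      by rewrite -(ltr_pM2r p0) -[X in _ && X](ltr_pM2r p0) -qE;
        move: sum_lt xv0 uy0; clear; lia.
    have [] : q = 0 \/ q != 0 by case: eqP; [left | right].
      by move=> q0 _ _; apply/eqP; rewrite -subr_eq0 qE q0 mul0r.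
    move: even_sub p_odd; rewrite qE; clear; lia.
  have : (v ^+ 2 - y ^+ 2) * (2 * p)%:Z = 0.
    rewrite mulrBl -{1}Exy -Euv.
    transitivity ((x * v) ^+ 2 - (u * y) ^+ 2); first by ring.
    by rewrite E subrr.
  move/eqP; rewrite mulf_eq0 => /orP[]; last by move: p0; clear; lia.
  rewrite subr_eq0 eqrXn2 ?(ltW y0) ?(ltW v0) // => /eqP vy.
  by split=> //; apply: (mulIf (lt0r_neq0 v0)); rewrite E vy.
have /andP[] : 0 < q < 2.
  by rewrite -(ltr_pM2r p0) -[X in _ && X](ltr_pM2r p0) -qE mul0r addr_gt0.
have : (2 %| x * v + u * y)%Z.
  by move: even_sub; move: (x * v) (u * y); clear; lia.
rewrite qE; move: p_odd; clear; lia.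
Qed.
End Thue.

(** * Triples of discriminant 8 p *)

Section Counting.
Local Open Scope ring_scope.

(** For $f(X) = aX^2 - 2bX - c$ these are $f(1) < 0$ and $f(-1) > 0$; with $a, c > 0$ they place the
    roots in $(1, \infty)$ and $(-1, 0)$. *)
Definition reduced_form (a b c : int) : bool :=
  (a < c + 2 * b) && (c < a + 2 * b).

Definition evenz (a : int) : bool := (2 %| a)%Z.

Lemma evenz_half (a : int) : evenz a -> {k : int | a = 2 * k}.
Proof. by move=> ea; exists (a %/ 2)%Z; move: ea; rewrite /evenz; lia. Qed.

Lemma oddz_half (a : int) : ~~ evenz a -> {k : int | a = 2 * k + 1}.
Proof. by move=> ea; exists (a %/ 2)%Z; move: ea; rewrite /evenz; lia. Qed.

Variable p : nat.

(* The substitutions X -> X + 1 and X -> X - 1 in a X^2 - 2 b X - c. *)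
Lemma card_even_b_gt :
  #|` forms p (fun a b c => evenz a && (a < b))|
  = #|` forms p (fun a b c => evenz a && (a + 2 * b < c))|.
Proof.
pose f (t : int * int * int) : int * int * int :=
  (t.1.1, t.1.2 - t.1.1, t.2 + 2 * t.1.2 - t.1.1).
pose g (t : int * int * int) : int * int * int :=
  (t.1.1, t.1.2 + t.1.1, t.2 - 2 * t.1.2 - t.1.1).
apply: (@card_fset_bij _ _ _ _ f g) => -[[a b] c];
  rewrite in_forms => /and5P[a0 b0 c0 /eqP E /andP[ea ab]];
    rewrite /f /g in_forms /=.
- split; last by congr (_, _, _); ring.
  by apply/and5P; split; rewrite ?ea /=; lia.
- split; last by congr (_, _, _); ring.
  by apply/and5P; split; rewrite ?ea /=; lia.
Qed.

Hypothesis p_odd : odd p.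

(** If $a$ is even then so is $b^2$, and an even $c$ would make $b^2 + ac$ divisible by $4$, unlike
    $2p$. *)
Lemma forms_parity (a b c : int) :
    b ^+ 2 + a * c = (2 * p)%:Z ->
  [/\ evenz a -> evenz b, evenz a -> ~~ evenz c
    & evenz a = evenz c -> ~~ evenz a /\ ~~ evenz b].
Proof.
move=> E.
have ab : evenz a -> evenz b.
  move=> /evenz_half[k ak]; apply/negPn/negP => /oddz_half[m bm].
  by move: E; rewrite ak bm; lia.
have ac : evenz a -> ~~ evenz c.
  move=> ea; have [m bm] := evenz_half (ab ea).
  have [k ak] := evenz_half ea; apply/negP => /evenz_half[n cn].
  move: E p_odd; rewrite ak bm cn; lia.
split=> // eac; have na : ~~ evenz a by apply/negP => ea; have := ac ea;
  rewrite -eac ea.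
split=> //; apply/negP => /evenz_half[m bm].
have [k ak] := oddz_half na.
have [n cn] : {n : int | c = 2 * n + 1} by apply: oddz_half; rewrite -eac.
by move: E; rewrite ak bm cn; lia.
Qed.

(** The involution is the substitution $X \mapsto 1 - X$. A fixed triple has $a = 2b$ with $b$ even,
    which makes $b^2 + ac$ divisible by $4$, unlike $2p$. *)
Lemma even_card_even_b_lt :
  ~~ odd #|` forms p (fun a b c => [&& evenz a, b < a & a < c + 2 * b])|.
Proof.
pose f (t : int * int * int) : int * int * int :=
  (t.1.1, t.1.1 - t.1.2, t.2 + 2 * t.1.2 - t.1.1).
apply: (@even_card_free_involution _ _ f) => -[[a b] c].
rewrite in_forms => /and5P[a0 b0 c0 /eqP E /and3P[ea ba ac]];
  rewrite /f in_forms /=.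
split; first by apply/and5P; split; rewrite ?ea /=; lia.
  by congr (_, _, _); ring.
apply/eqP => -[ab _].
have [/(_ ea) /evenz_half[m bm] nc _] := forms_parity E.
by move: E p_odd; have -> : a = 4 * m by [lia]; rewrite bm; lia.
Qed.

Hypothesis p_prime : prime p.

(** With $a = b = 2k$ the equation becomes $k(2k + c) = p$; $k = p$ is too large, so $k = 1$. *)
Lemma card_even_diag :
  #|` forms p (fun a b c => evenz a && (b == a))| = 1%N.
Proof.
have p1 := prime_gt1 p_prime.
have -> : forms p (fun a b c => evenz a && (b == a))
        = [fset (2, 2, p%:Z - 2)]%fset;
  last by rewrite cardfs1.
apply/fsetP => -[[a b] c]; rewrite in_forms !inE.
apply/idP/eqP => [/and5P[a0 b0 c0 /eqP E /andP[/evenz_half[k ak] /eqP ba]]|].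
  have kp : k * (2 * k + c) = p%:Z by move: E; rewrite ba ak; lia.
  have kdiv : (`|k|%N %| p)%N by apply/dvdnP; exists `|(2 * k + c)%R|%N; lia.
  have [k1|k1] : (`|k| = 1 \/ `|k| = p)%N.
    by move: (primeP p_prime).2 => /(_ _ kdiv) /orP[] /eqP ?; [left|right].
    have {}k1 : k = 1 by lia.
    by move: kp; rewrite ba ak k1 => kp; congr (_, _, _); lia.
  have {}k1 : k = p%:Z by lia.
  by exfalso; move: kp p1; rewrite k1; nia.
move=> [-> -> ->]; apply/and5P; split=> //.
- by move: p_odd; lia.
- by lia.
Qed.

(** Among triples with $a$ even, the non-reduced ones with $c > a + 2b$ match those with $a < b$,
    and the other non-reduced ones, with $a \ge c + 2b$, all have $b < a$. So the reduced ones are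
    as many as those with $b = a$, a single triple, plus those with $b < a < c + 2b$, an even
    number. *)
Lemma odd_card_even_reduced :
  odd #|` forms p (fun a b c => reduced_form a b c && evenz a)|.
Proof.
have e1 := card_forms_sieve p (fun a b c => evenz a) (fun a b c => b < a).
have e2 := card_forms_sieve p
  (fun a b c => evenz a && ~~ (b < a)) (fun a b c => b == a).
have e3 := card_forms_sieve p
  (fun a b c => evenz a && (b < a)) (fun a b c => a < c + 2 * b).
have e4 := card_forms_sieve p (fun a b c => evenz a) reduced_form.
have e5 := card_forms_sieve p
  (fun a b c => evenz a && ~~ reduced_form a b c) (fun a b c => a < c + 2 * b).
have := card_even_b_gt; have := card_even_diag; have := even_card_even_b_lt.
have <- : forms p (fun a b c : int => (evenz a && (b < a)) && (a < c + 2 * b)) =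
         forms p (fun a b c => [&& evenz a, b < a & a < c + 2 * b]).
  by apply: eq_forms => a b c *; rewrite andbA.
have <- : forms p (fun a b c : int => (evenz a && ~~ (b < a)) && (b == a)) =
         forms p (fun a b c => evenz a && (b == a)).
  by apply: eq_forms => a b c *; case: (evenz a) => //=; lia.
have <- : forms p (fun a b c : int => (evenz a && ~~ (b < a)) && (b != a)) =
         forms p (fun a b c => evenz a && (a < b)).
  by apply: eq_forms => a b c *; case: (evenz a) => //=; lia.
have <- : forms p (fun a b c =>
            (evenz a && ~~ reduced_form a b c) && (a < c + 2 * b)) =
          forms p (fun a b c => evenz a && (a + 2 * b < c)).
  apply: eq_forms => a b c a0 b0 c0 E; case ea: (evenz a) => //=.
  (* Equality $c = a + 2b$ is excluded, since $a$ is even and $c$ is odd. *)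
  have [_ /(_ ea) + _] := forms_parity E; move: ea;
    rewrite /reduced_form /evenz; lia.
have E6 : forms p (fun a b c =>
            (evenz a && ~~ reduced_form a b c) && ~~ (a < c + 2 * b)) =
          forms p (fun a b c => (evenz a && (b < a)) && ~~ (a < c + 2 * b)).
  apply: eq_forms => a b c a0 b0 c0 E; case ea: (evenz a) => //=.
  by rewrite /reduced_form; lia.
have -> : forms p (fun a b c => reduced_form a b c && evenz a) =
          forms p (fun a b c => evenz a && reduced_form a b c).
  by apply: eq_forms => a b c *; rewrite andbC.
rewrite E6 in e5.
move: e1 e2 e3 e4 e5; lia.
Qed.

(** On the diagonal the equation is $a^2 + b^2 = 2p$. From $p = x^2 + y^2$ comes $2p = (y - x)^2 +
    (x + y)^2$, and $a = b$ would make $p$ a square. *)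
Lemma card_diag :
  p = 1 %[mod 4] -> #|` forms p (fun a b c => a == c)| = 2%N.
Proof.
move=> p4.
have [x [y [x0 xy E]]] : exists x y : int,
    [/\ 0 < x, x < y & x ^+ 2 + y ^+ 2 = (2 * p)%:Z].
  have [x [y E]] := exists_sum_two_squares p_prime p4.
  have p1 : ~~ (p %| 1)%N by rewrite dvdn1; have := prime_gt1 p_prime; lia.
  have neq0 (m n : int) : m ^+ 2 + n ^+ 2 = p%:Z -> m != 0.
    move=> E0; apply/eqP => m0; have : n ^+ 2 = (p * 1)%:Z * 1 ^+ 2.
      by rewrite muln1 expr1n mulr1 -E0 m0 expr0n add0r.
    by move/(sqrz_eq_prime_mul p_prime p1).
  have x0 : 0 < `|x| by rewrite normr_gt0 (neq0 _ y).
  have y0 : 0 < `|y| by rewrite normr_gt0 (neq0 _ x) // addrC.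
  have {E} : `|x| ^+ 2 + `|y| ^+ 2 = p%:Z by rewrite !real_normK ?num_real.
  move: `|x| `|y| x0 y0 => {}x {}y x0 y0 E.
  have [xy|xy|xy] := ltgtP x y.
  - exists (y - x), (x + y); split; [by lia|by lia|].
    by rewrite PoszM -E; ring.
  - exists (x - y), (x + y); split; [by lia|by lia|].
    by rewrite PoszM -E; ring.
  - by exfalso; move: E p_odd; rewrite xy; clear; lia.
have -> : forms p (fun a b c => a == c) = [fset (x, y, x); (y, x, y)]%fset.
  apply/fsetP => -[[a b] c]; rewrite in_forms !inE.
  have y0 : 0 < y := lt_trans x0 xy.
  apply/idP/orP.
    move=> /and5P[a0 b0 c0 /eqP Eabc /eqP ac]; move: Eabc; rewrite -{c0}ac =>
      Eab.
    have uniq := sum_two_squares_unique p_prime p_odd.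
    have [ab|ba|ab] := ltgtP a b.
    + left; apply/eqP; have [|-> -> //] := uniq x y a b x0 xy a0 ab E.
      by rewrite addrC.
    + by right; apply/eqP; have [-> ->] := uniq x y b a x0 xy b0 ba E Eab.
    + exfalso; move: Eab; rewrite ab => Eab.
      have Ebp : b ^+ 2 = (p * 1)%:Z * 1 ^+ 2 by move: Eab; clear; lia.
      have p1 : ~~ (p %| 1)%N by rewrite dvdn1; have := prime_gt1 p_prime; lia.
      by move/(sqrz_eq_prime_mul p_prime p1): Ebp.
  case=> /eqP[-> -> ->]; rewrite x0 y0 eqxx andbT /= -E -expr2 //.
  by rewrite addrC.
rewrite cardfs2 xpair_eqE; suff -> : ((x, y) == (y, x)) = false by [].
by apply/negbTE/eqP => -[yx _]; move: xy; rewrite yx ltxx.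
Qed.

(* The fixed points of the involution in odd_card_reduced_lt. *)
Definition exchange_fixed (a b c : int) : bool := (a < c) && (a + c == 2 * b).

(** Writing $a = b - e$ and $c = b + e$ gives $2b^2 - e^2 = 2p$, so $e = 2y$ is even; $2y < b$ is
    the positivity of $a$. *)
Lemma exchange_fixed_norm a b c : (a, b, c) \in forms p exchange_fixed ->
  exists y, [/\ a = b - 2 * y, c = b + 2 * y, 0 < y, 2 * y < b
    & b ^+ 2 - 2 * y ^+ 2 = p%:Z].
Proof.
rewrite in_forms => /and5P[a0 b0 c0 /eqP E /andP[ac /eqP abc]].
have [e aE] : exists e, a = b - e by exists (b - a); ring.
have cE : c = b + e by lia.
rewrite aE cE in E *.
have ee : evenz e.
  apply/negPn/negP => /oddz_half[k ek].
  by move: E; rewrite ek; clear; lia.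
have [y ey] := evenz_half ee; exists y; rewrite ey in aE cE E *; split=> //;
  try lia.
Qed.

(** An odd value of $b^2 - 2y^2$ is $\pm 1$ modulo $8$; the residues of $b$ modulo $4$ and of $y$
    modulo $2$ already decide this. *)
Lemma card_exchange_fixed_mod8_5 :
  p = 5 %[mod 8] -> #|` forms p exchange_fixed| = 0%N.
Proof.
move=> p5; apply/eqP; rewrite cardfs_eq0; apply/eqP/fsetP => -[[a b] c].
rewrite in_fset0; apply/negP => /exchange_fixed_norm[y [_ _ _ _]].
have [k [m [n [pE bE yE]]]] : exists k m n, [/\ p%:Z = 8 * k + 5,
    b = 4 * m \/ b = 4 * m + 1 \/ b = 4 * m + 2 \/ b = 4 * m + 3
    & y = 2 * n \/ y = 2 * n + 1].
  exists (p %/ 8)%:Z, (b %/ 4)%Z, (y %/ 2)%Z; split; lia.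
by rewrite pE; case: bE yE => [->|[->|[->|->]]] [->|->]; clear; lia.
Qed.

Lemma card_exchange_fixed_mod8_1 :
  p = 1 %[mod 8] -> #|` forms p exchange_fixed| = 1%N.
Proof.
move=> p1; have [x [y [y0 yx E]]] := exists_norm_sqrt2 p_prime p1.
rewrite -(cardfs1 (x - 2 * y, x, x + 2 * y)); congr (size _); congr enum_fset.
apply/fsetP => -[[a b] c]; rewrite in_fset1; apply/idP/eqP.
  move=> /exchange_fixed_norm[v [-> -> v0 vu E']].
  by have [-> ->] := norm_sqrt2_unique p_prime y0 yx v0 vu E E'.
move=> [-> -> ->]; rewrite in_forms /exchange_fixed; apply/and5P; split; lia.
Qed.

(** With $k = (c - a)/2$ the map $(a, b, c) \mapsto (b - k, a + k, b + k)$ exchanges $a + c$ with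
    $2b$ and keeps $c - a$. As $a < c$, being reduced means $k < b$, that is, a positive first entry
    of the image; the same holds with the roles exchanged. *)
Lemma odd_card_reduced_lt :
  odd #|` forms p
            (fun a b c => [&& reduced_form a b c, evenz a == evenz c & a < c])|
  = odd #|` forms p exchange_fixed|.
Proof.
pose e (t : int * int * int) : int := ((t.2 - t.1.1) %/ 2)%Z.
pose f (t : int * int * int) : int * int * int :=
  (t.1.2 - e t, t.1.1 + e t, t.1.2 + e t).
have half a b c : evenz a == evenz c -> {k | c = a + 2 * k & e (a, b, c) = k}.
  by rewrite /e /evenz /= => ac; exists ((c - a) %/ 2)%Z => //; lia.
rewrite (@odd_card_involution _ _ f).
  congr (odd (size _)); congr enum_fset.
  apply/fsetP => -[[a b] c].
  apply/idP/idP.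
    rewrite in_fset_filter => /andP[].
    rewrite !in_forms => /and5P[a0 b0 c0 E /and3P[abc ac ltac]].
    have [k ck ek] := half a b c ac; rewrite /f ek /= => /eqP[h1 h2 h3].
    by apply/and5P; split; rewrite // /exchange_fixed ltac; apply/eqP; lia.
  move=> h; have [y [ay cy y0 yb E']] := exchange_fixed_norm h.
  rewrite in_fset_filter; move: h; rewrite !in_forms => /and5P[a0 b0 c0 E _].
  have ac : evenz a == evenz c by rewrite ay cy /evenz; lia.
  have [k ck ek] := half a b c ac; apply/andP; split.
    by apply/and5P; split; rewrite // ac /reduced_form; lia.
  by rewrite /f ek /=; apply/eqP; congr (_, _, _); lia.
move=> [[a b] c].
rewrite in_forms => /and5P[a0 b0 c0 /eqP E /and3P[/andP[abc cab] ac ltac]].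
have [k ck ek] := half a b c ac.
have fE : f (a, b, c) = (b - k, a + k, b + k) by rewrite /f ek.
have ac' : evenz (b - k) == evenz (b + k) by rewrite /evenz; lia.
have [k' ck' ek'] := half (b - k) (a + k) (b + k) ac'.
rewrite fE in_forms; split.
  by apply/and5P; split; rewrite ?ac' /reduced_form /=; try lia; move: E;
    rewrite ck; clear; lia.
by rewrite /f ek' /=; congr (_, _, _); lia.
Qed.

(** Twice a cardinal modulo $4$ depends only on its parity. The summands come from the diagonal,
    from $a \ne c$ of equal parity (twice the part $a < c$), and from opposite parities (twice the
    part with $a$ even). *)
Lemma card_reduced_mod4 : p = 1 %[mod 4] ->
  #|` forms p reduced_form|
  = 2 + 2 * (odd #|` forms p exchange_fixed|) + 2 %[mod 4].
Proof.
move=> p4.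
have e1 := card_forms_sieve p reduced_form (fun a b c => evenz a == evenz c).
have e2 := card_forms_sieve p
  (fun a b c => reduced_form a b c && (evenz a != evenz c))
  (fun a b c => evenz a).
pose offdiag a b c := (reduced_form a b c && (evenz a == evenz c)) && (a != c).
have e3 : _ = (_ + #|` forms p offdiag|)%N := card_forms_sieve p
  (fun a b c => reduced_form a b c && (evenz a == evenz c))
  (fun a b c => a == c).
have e4 := card_forms_sieve p offdiag (fun a b c => a < c).
have := odd_card_even_reduced; have := odd_card_reduced_lt.
have := card_diag p4.
have <- : forms p (fun a b c =>
            (reduced_form a b c && (evenz a == evenz c)) && (a == c)) =
          forms p (fun a b c => a == c).
  by apply: eq_forms => a b c *; rewrite /reduced_form /evenz; lia.
have e5 : #|` forms p (fun a b c => offdiag a b c && ~~ (a < c))|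
        = #|` forms p (fun a b c => offdiag a b c && (a < c))|.
  rewrite card_forms_swap; congr (size _); congr enum_fset.
  by apply: eq_forms => a b c *; rewrite /offdiag /reduced_form /evenz; lia.
have <- : forms p (fun a b c => offdiag a b c && (a < c)) =
          forms p (fun a b c =>
            [&& reduced_form a b c, evenz a == evenz c & a < c]).
  by apply: eq_forms => a b c *; rewrite /offdiag /reduced_form /evenz; lia.
have e6 : forms p (fun a b c =>
            (reduced_form a b c && (evenz a != evenz c)) && evenz a) =
          forms p (fun a b c => reduced_form a b c && evenz a).
  apply: eq_forms => a b c a0 b0 c0 E; have [_ h _] := forms_parity E.
  by move: h; rewrite /reduced_form /evenz; lia.
have e7 : #|` forms p (fun a b c =>
                (reduced_form a b c && (evenz a != evenz c)) && ~~ evenz a)|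
        = #|` forms p (fun a b c => reduced_form a b c && evenz a)|.
  rewrite card_forms_swap; congr (size _); congr enum_fset.
  apply: eq_forms => a b c a0 b0 c0 E; have [_ h _] := forms_parity E.
  by move: h; rewrite /reduced_form /evenz; lia.
rewrite e6 e7 in e2; rewrite e5 in e4.
move: e1 e2 e3 e4; clear; lia.
Qed.

End Counting.

(** * Reduced numbers and triples *)

Section KappaForms.
Local Open Scope ring_scope.
Variable (R : realType) (p : nat).
Hypothesis p_odd : odd p.
Hypothesis p_prime : prime p.

Let s : R := Num.sqrt (2 * p)%:R.

Lemma sqr_rat_neq (q : rat) : q ^+ 2 != (2 * p)%:R.
Proof.
apply/eqP => E; have d0 : (denq q)%:~R != 0 :> rat by rewrite intr_eq0
  denq_neq0.
have : numq q ^+ 2 = (p * 2)%:Z * denq q ^+ 2.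
  have [D DE] : exists D, D = (p * 2)%:Z by exists (p * 2)%:Z.
  apply/eqP; rewrite -(eqr_int rat) -DE !expr2 !rmorphM /= -!expr2 DE.
  rewrite -[_%:~R in X in _ == X]pmulrn mulnC -E.
  by rewrite -[X in _ == X ^+ 2 * _]divq_num_den expr_div_n divfK ?expf_neq0.
have p2 : ~~ (p %| 2)%N.
  by rewrite dvdn_prime2 //; apply/eqP => p2; move: p_odd; rewrite p2.
by move/(sqrz_eq_prime_mul p_prime p2)/eqP; rewrite (negPf (denq_neq0 q)).
Qed.

Lemma sqrt_2p_sqr : s ^+ 2 = (2 * p)%:R.
Proof. by rewrite sqr_sqrtr ?ler0n. Qed.

Lemma sqrt_2p_gt0 : 0 < s.
Proof. by rewrite sqrtr_gt0 ltr0n muln_gt0 (prime_gt0 p_prime). Qed.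

Lemma sqrt_2p_irrational (q : rat) : s != ratr q.
Proof.
apply/eqP => E; have := sqrt_2p_sqr; rewrite E -rmorphXn /= -[RHS]ratr_nat.
by move/fmorph_inj/eqP; rewrite (negPf (sqr_rat_neq q)).
Qed.

Definition form_root (t : int * int * int) : R :=
  (t.1.2%:~R + s) / t.1.1%:~R.

(** Since $\sqrt{2p}$ is irrational, equal roots have equal $a$ and $b$, and the equation then
    determines $c$. *)
Lemma form_root_inj : {in forms p reduced_form &, injective form_root}.
Proof.
move=> [[a b] c] [[a' b'] c']; rewrite !in_forms.
move=> /and5P[a0 b0 c0 /eqP E _] /and5P[a0' b0' c0' /eqP E' _].
have A0 : a%:~R != 0 :> R by rewrite intr_eq0 gt_eqF.
have A0' : a'%:~R != 0 :> R by rewrite intr_eq0 gt_eqF.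
rewrite /form_root /= => /eqP; rewrite eqr_div // => /eqP eqw.
have {eqw} eqw : s * (a' - a)%:~R = (a * b' - a' * b)%:~R.
  rewrite !rmorphB !rmorphM /=; apply/eqP; rewrite -subr_eq0; apply/eqP.
  transitivity ((b%:~R + s) * a'%:~R - (b'%:~R + s) * a%:~R); first by ring.
  by rewrite eqw subrr.
have aa : a' = a.
  apply/eqP; rewrite -subr_eq0; apply/negPn/negP => a0N.
  have /eqP[] := sqrt_2p_irrational ((a * b' - a' * b)%:~R / (a' - a)%:~R).
  by rewrite fmorph_div /= !ratr_int -eqw mulfK // intr_eq0.
move: eqw; rewrite aa subrr mulr0 -mulrBr => /esym/eqP.
rewrite intr_eq0 mulf_eq0 (gt_eqF a0) subr_eq0 /= => /eqP bb.
congr (_, _, _) => //.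
by apply: (mulfI (lt0r_neq0 a0)); move: E'; rewrite -E aa bb => /addrI.
Qed.

(** Primitivity, as [has_disc] requires: $g$ is odd because $a$ and $c$ are not both even, and $g^2$
    divides $(2b)^2 + 4ac = 8p$; so $g^2$ divides $p$, and $g = 1$. *)
Lemma gcd_forms a b c : b ^+ 2 + a * c = (2 * p)%:Z ->
  gcdz (gcdz a (- (2 * b))) (- c) = 1.
Proof.
move=> E; set g := gcdz _ _.
have ga : (g %| a)%Z by apply: dvdz_trans (dvdz_gcdl _ _) (dvdz_gcdl _ _).
have gb : (g %| 2 * b)%Z.
  by rewrite -rpredN; apply: dvdz_trans (dvdz_gcdl _ _) (dvdz_gcdr _ _).
have gc : (g %| c)%Z by rewrite -rpredN; apply: dvdz_gcdr.
have g_odd : odd `|g|%N.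
  apply/negPn/negP; rewrite -dvdn2 => g2.
  have {}g2 : (2 %| g)%Z by rewrite dvdzE.
  have [_ /(_ (dvdz_trans g2 ga)) /negP[]] := forms_parity p_odd E.
  exact: dvdz_trans g2 gc.
have g2p : (`|g| ^ 2 %| p)%N.
  have cop : coprime (`|g| ^ 2) 8.
    by rewrite coprimeXl // -[8%N]/(2 ^ 3)%N coprimeXr // coprimen2.
  rewrite -(Gauss_dvdr _ cop).
  have -> : (8 * p)%N = `|((2 * b) * (2 * b) + 4 * (a * c))%R|%N by move: E;
    clear; lia.
  have gg_b : (g * g %| (2 * b) * (2 * b))%Z by apply: dvdz_mul.
  have gg_ac : (g * g %| 4 * (a * c))%Z by apply/dvdz_mull/dvdz_mul.
  by rewrite expnS expn1 -abszM -dvdzE rpredD.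
have /orP[/eqP|/eqP gp] := (primeP p_prime).2 _ (dvdn_trans (dvdn_exp2l _ (isT
  : 1 <= 2)%N) g2p).
  by rewrite expn1 => g1; rewrite -[g]gez0_abs // g1.
rewrite expn1 in gp; have := dvdn_leq (prime_gt0 p_prime) g2p.
by rewrite gp -mulnn leqNgt ltn_Pmulr ?prime_gt0 ?prime_gt1.
Qed.

Lemma form_root_quad a b c : 0 < a -> b ^+ 2 + a * c = (2 * p)%:Z ->
  forall e : R, e ^+ 2 = (2 * p)%:R ->
  quad_root a (- (2 * b)) (- c) ((b%:~R + e) / a%:~R).
Proof.
move=> a0 E e e2; have A0 : a%:~R != 0 :> R by rewrite intr_eq0 gt_eqF.
have ER : b%:~R ^+ 2 + a%:~R * c%:~R = (2 * p)%:R :> R.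
  by rewrite pmulrn -E rmorphD /= !expr2 !rmorphM.
rewrite /quad_root !rmorphN rmorphM /=.
transitivity ((e ^+ 2 - (b%:~R ^+ 2 + a%:~R * c%:~R)) / a%:~R); first by field.
by rewrite ER e2 subrr mul0r.
Qed.

Lemma form_conjugate a b c : 0 < a -> b ^+ 2 + a * c = (2 * p)%:Z ->
  conjugate ((b%:~R + s) / a%:~R) ((b%:~R - s) / a%:~R).
Proof.
move=> a0 E; have A0 : a%:~R != 0 :> R by rewrite intr_eq0 gt_eqF.
have a0Q : a%:~R != 0 :> rat by rewrite intr_eq0 gt_eqF.
split.
  apply/eqP => /(mulIf (invr_neq0 A0))/addrI sN.
  by have := sqrt_2p_gt0; move: sN; lra.
pose P : {poly rat} := a%:~R *: 'X^2 + (- (2 * b))%:~R *: 'X + (- c)%:~R%:P.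
have PE x : (map_poly ratr P).[x] =
    a%:~R * x ^+ 2 + (- (2 * b))%:~R * x + (- c)%:~R :> R.
  rewrite /P !rmorphD /= !map_polyZ map_polyXn map_polyX map_polyC /=.
  by rewrite !ratr_int !hornerE.
exists P; split; last 2 first.
- by rewrite /root PE; apply/eqP; exact: form_root_quad sqrt_2p_sqr.
- by rewrite /root PE; apply/eqP/form_root_quad => //;
    rewrite sqrrN sqrt_2p_sqr.
have szP : size P = 3%N.
  rewrite /P -addrA size_polyDl size_scale ?size_polyXn //.
  rewrite (leq_ltn_trans (size_polyD _ _)) // gtn_max.
  rewrite (leq_ltn_trans (size_scale_leq _ _)) ?size_polyX //=.
  by rewrite (leq_ltn_trans (size_polyC_leq1 _)).
(* In degree two the absence of rational roots suffices; a rational root $x$ would give $(ax - b)^2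
   = 2p$. *)
apply: cubic_irreducible; rewrite ?szP // => x; apply/negP.
rewrite /root /P !hornerE => /eqP Px.
have /eqP[] := sqr_rat_neq (a%:~R * x - b%:~R).
have -> : (2 * p)%:R = b%:~R ^+ 2 + a%:~R * c%:~R :> rat.
  by rewrite pmulrn -E rmorphD /= !expr2 !rmorphM.
move: Px; rewrite !rmorphN rmorphM /= => Px.
apply/eqP; rewrite -subr_eq0; apply/eqP.
transitivity (a%:~R * (a%:~R * x ^+ 2 - 2 * b%:~R * x - c%:~R)); first by ring.
by rewrite -[RHS](mulr0 a%:~R) -Px; congr (_ * _); ring.
Qed.


Lemma form_root_reduced a b c : (a, b, c) \in forms p reduced_form ->
  reduced (form_root (a, b, c)).
Proof.
rewrite in_forms => /and5P[a0 b0 c0 /eqP E /andP[abc cab]].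
have A0 : 0 < a%:~R :> R by rewrite ltr0z.
have B0 : 0 < b%:~R :> R by rewrite ltr0z.
have C0 : 0 < c%:~R :> R by rewrite ltr0z.
have ABC : a%:~R < c%:~R + 2 * b%:~R :> R.
  by move: abc; rewrite -(ltr_int R) rmorphD rmorphM.
have CAB : c%:~R < a%:~R + 2 * b%:~R :> R.
  by move: cab; rewrite -(ltr_int R) rmorphD rmorphM.
have s2 : s ^+ 2 = b%:~R ^+ 2 + a%:~R * c%:~R.
  by rewrite sqrt_2p_sqr pmulrn -E rmorphD /= !expr2 !rmorphM.
have s0 := sqrt_2p_gt0; rewrite /form_root /=; split.
- split.
    move=> [q _ qE]; have /eqP[] := sqrt_2p_irrational (a%:~R * q - b%:~R).
    rewrite rmorphB rmorphM /= !ratr_int qE mulrC divfK ?gt_eqF //.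
    by rewrite addrC addKr.
  exists a, (- (2 * b)), (- c); split; first by rewrite gt_eqF.
  exact: form_root_quad sqrt_2p_sqr.
- by rewrite ltr_pdivlMr // mul1r; nra.
exists ((b%:~R - s) / a%:~R); first exact: form_conjugate a0 E.
by rewrite ltr_pdivlMr // ltr_pdivrMr // mul0r mulN1r; apply/andP; split; nra.
Qed.

Lemma form_root_has_disc a b c : (a, b, c) \in forms p reduced_form ->
  has_disc (form_root (a, b, c)) (8 * p)%:Z.
Proof.
rewrite in_forms => /and5P[a0 b0 c0 /eqP E _].
exists a, (- (2 * b)), (- c); split=> //.
- exact: form_root_quad sqrt_2p_sqr.
- exact: gcd_forms.
- by move: E; clear; lia.
Qed.

(** The discriminant forces $b = -2k$. By Vieta $a(w + w') = 2k$ and $aww' = c$, so the triple $(a,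
    k, -c)$ and [s] $= a(w - w')/2$ are read off from the two roots. *)
Lemma reduced_form_root w : reduced w -> has_disc w (8 * p)%:Z ->
  exists2 t, t \in forms p reduced_form & form_root t = w.
Proof.
move=> [_ w1 [w' cw /andP[w'1 w'0]]] [a [b [c [rw a0 _ Dabc]]]].
have rw' := conjugate_quad_root rw cw.
have ww' : w - w' != 0 by rewrite subr_eq0 eq_sym; case: cw.
rewrite /quad_root in rw rw'.
have [k bk] : {k | b = - (2 * k)}.
  have /evenz_half[k bk] : evenz b.
    apply/negPn/negP => /oddz_half[k bk].
    by move: Dabc; rewrite bk; clear; lia.
  by exists (- k); rewrite bk; ring.
have A0 : 0 < a%:~R :> R by rewrite ltr0z.
have sum_roots : a%:~R * (w + w') = 2 * k%:~R.
  apply/eqP; rewrite -subr_eq0; apply/eqP/(mulfI ww').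
  rewrite mulr0 -[RHS](subrr 0) -{1}rw -{1}rw' bk rmorphN rmorphM /=; ring.
have prod_roots : a%:~R * w * w' = c%:~R.
  apply/eqP; rewrite -subr_eq0; apply/eqP.
  rewrite -[RHS]oppr0 -rw bk rmorphN rmorphM /= -sum_roots; ring.
have E : k ^+ 2 + a * (- c) = (2 * p)%:Z by move: Dabc; rewrite bk; clear; lia.
have ER : (2 * p)%:R = k%:~R ^+ 2 - a%:~R * c%:~R :> R.
  by rewrite pmulrn -E rmorphD /= expr2 !rmorphM rmorphN mulrN.
have sE : s = a%:~R * (w - w') / 2.
  have -> : s = Num.sqrt ((a%:~R * (w - w') / 2) ^+ 2).
    congr Num.sqrt; rewrite ER -prod_roots.
    have -> : k%:~R = a%:~R * (w + w') / 2 :> R by rewrite sum_roots; field.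
    by field.
  rewrite sqrtr_sqr ger0_norm // divr_ge0 // mulr_ge0 ?(ltW A0) //; lra.
exists (a, k, - c); last first.
  rewrite /form_root /= sE; have -> : k%:~R = a%:~R * (w + w') / 2 :> R.
    by rewrite sum_roots; field.
  by field; rewrite gt_eqF.
have k0 : 0 < k by rewrite -(ltr0z R); nra.
have c0 : 0 < - c by rewrite oppr_gt0 -(ltrz0 R) -prod_roots pmulr_rlt0
  ?mulr_gt0 //; lra.
(* Expanded, the two products are $2k - c - a$ and $a + 2k + c$: their positivity is [reduced_form]
   for $(a, k, -c)$. *)
have f1 : 0 < a%:~R * ((w - 1) * (1 - w')) by rewrite !mulr_gt0 //; lra.
have f2 : 0 < a%:~R * ((w + 1) * (w' + 1)) by rewrite !mulr_gt0 //; lra.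
have abc : a < - c + 2 * k.
  by rewrite -(ltr_int R) rmorphD rmorphN rmorphM /= -prod_roots -sum_roots;
    nra.
have cab : - c < a + 2 * k.
  by rewrite -(ltr_int R) rmorphD rmorphN rmorphM /= -prod_roots -sum_roots;
    nra.
by rewrite in_forms a0 k0 c0 E eqxx /reduced_form abc.
Qed.

Lemma kappa_forms : kappa R (8 * p) = #|` forms p reduced_form|.
Proof.
rewrite /kappa; have -> : fset_set (@reduced_of_disc R (8 * p)) =
    (form_root @` forms p reduced_form)%fset.
  apply/fsetP => w; rewrite in_fset_set; last exact: reduced_of_disc_finite.
  apply/idP/imfsetP => [|[[[a b] c] abc ->]].
    by rewrite inE => -[rw dw]; have [t] := reduced_form_root rw dw; exists t.
  by rewrite inE; split; [exact: form_root_reduced | exact: form_root_has_disc].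
by rewrite card_in_imfset //; exact: form_root_inj.
Qed.
End KappaForms.

Theorem theorem3p5 (R : realType) (p : nat) :
  prime p -> p = 1 %[mod 4] ->
  (p = 1 %[mod 8] -> kappa R (8 * p) = 2 %[mod 4]) /\
  (p = 5 %[mod 8] -> kappa R (8 * p) = 0 %[mod 4]).
Proof.
move=> p_prime p4; have p_odd : odd p by lia.
(* The count is congruent to $6$ or to $4$, according to whether there is one fixed triple or
   none. *)
rewrite kappa_forms // card_reduced_mod4 //; split=> p8.
  by rewrite card_exchange_fixed_mod8_1.
by rewrite card_exchange_fixed_mod8_5.
Qed.
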